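(* Let $A := \{ (8k-3)(8l+3) \mid k, l \in \mathbb{Z} \}$. Then $A \subsetneq \{ 8m-1 \mid m \in \mathbb{Z} \}$, and $$S\left(\mathrm{C}_2^4\right) = \left\{ 16m+1,\; 2^{16}(4m+1),\; 2^{24}(4m+1),\; 2^{24}(8m+3),\; 2^{24}m',\; 2^{26}m \;\middle|\; m \in \mathbb{Z},\ m' \in A \right\}.$$
   Context: $\mathrm{C}_2$ is the cyclic group of order $2$, and $\mathrm{C}_2^4$ is the direct product of four copies of it. For a finite group $G$ and integers $x_g$ ($g \in G$), the integer group determinant is $\det(x_{gh^{-1}})_{g,h\in G}$ (the determinant of the matrix with rows and columns indexed by $G$ whose $(g,h)$ entry is $x_{gh^{-1}}$). $S(G)$ denotes the set of all its possible values: $S(G) := \{ \det(x_{gh^{-1}})_{g,h\in G} \mid x_g \in \mathbb{Z} \}$. The right-hand side of the displayed equality is the union of the six sets obtained by letting $m$ range over $\mathbb{Z}$ and $m'$ over $A$ in each of the listed expressions. *)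

(* Defs.v *)
From HB Require Import structures.
From mathcomp Require Import all_boot all_order all_algebra all_fingroup.
From mathcomp Require Import classical_sets.

Set Implicit Arguments.
Unset Strict Implicit.
Unset Printing Implicit Defensive.

Import GRing.Theory.
Local Open Scope classical_set_scope.
Local Open Scope ring_scope.

(* Rows and columns are indexed by the elements of gT through the library's
   enumeration of the finite type gT; the determinant does not depend on it. *)
Definition group_matrix (gT : finGroupType) (x : gT -> int) : 'M[int]_#|gT| :=
  \matrix_(i, j) x (enum_val i * (enum_val j)^-1)%g.

Definition group_det (gT : finGroupType) (x : gT -> int) : int :=
  \det (group_matrix x).

Definition group_dets (gT : finGroupType) : set int :=
  [set group_det x | x in [set: gT -> int]].

(* The group law on 'Z_2 is addition modulo 2, and that on the product is
   componentwise. *)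
Definition C2 : finGroupType := 'Z_2.
Definition C2_4 : finGroupType := (C2 * C2 * C2 * C2)%type.

Definition A : set int :=
  [set (8 * k - 3) * (8 * l + 3) | k in [set: int] & l in [set: int]].

(* Main.v *)
Require Import Defs.
From HB Require Import structures.
From mathcomp Require Import all_boot all_order all_algebra all_fingroup.
From mathcomp Require Import classical_sets.
From mathcomp Require Import zify ring.

Set Implicit Arguments.
Unset Strict Implicit.
Unset Printing Implicit Defensive.

Import GRing.Theory.
Local Open Scope classical_set_scope.
Local Open Scope ring_scope.

(** Write [chi g h] for the sign characters of C_2^4 and [y h], [fourier] below,
for the sixteen character sums of [x].  The group matrix is diagonalised by the
character table, so the group determinant is the product of the [y h]
([group_detE]); conversely [16 x] is the transform of [y] ([fourier_inv]).

The key fact is that [y h] modulo 4 is an affine function of [h]: with [s] the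
sum of the [x g] and [t] the product of the [g ^ (x g)], one has
[y h = s + chi t h - 1] modulo 4 ([fourier_mod4]).  This splits the problem.

- If [s] is odd, then after multiplication by the signs [+- chi t h] every
  [y h] is 1 modulo 4, and a product of factors that are 1 modulo 4 is
  determined modulo 16 by their sum, here a multiple of 16.  So the
  determinant is 1 modulo 16.

- If [s] is even and [t = 1], the [y h] are all 0 modulo 4, which gives a
  multiple of [2^32], or all 2 modulo 4, and the same principle applied to
  [y h / 2] gives [2^16 (4m + 1)].

- If [s] is even and [t <> 1], eight of the [y h] are [2 z] with [z] odd and the
  other eight are [4 u].  The sum of the [u] is even, so an even number of them
  is even; if there is one, [2^26] divides the determinant.  Otherwise the
  determinant is [2^24 N] with [N] odd, and only [N = 7] modulo 8 requires an
  argument.  If a factor of [N] is 3 or -3 modulo 8, then [N] lies in [A].  If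
  all are 1 or -1 modulo 8, replace them by their signs: the congruences linking
  the partial transforms of the [z] and of the [u], combined with Parseval's
  identity, force the product of the signs to be 1 ([half_prod_mod8]), so [N] is
  1 modulo 8 after all.

Every listed value occurs: for each family an explicit [x], affine in the
parameters, was obtained by inverting the transform on a suitable [y]. *)

(** * Characters and the determinant *)

Lemma mulr_signed (a b : int) : a = 1 \/ a = -1 -> b = 1 \/ b = -1 ->
  a * b = 1 \/ a * b = -1.
Proof. by case=> ->; case=> ->; [left|right|right|left]. Qed.

Lemma C2P (a : C2) : a = 0%R :> 'Z_2 \/ a = 1%R :> 'Z_2.
Proof. by case: a => -[|[|]] // i; [left|right]; apply: val_inj. Qed.

Lemma bigC2 (R : Type) (idx : R) (op : Monoid.law idx) (f : C2 -> R) :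
  \big[op/idx]_a f a = op (f (0%R : 'Z_2)) (f (1%R : 'Z_2)).
Proof.
rewrite (_ : \big[op/idx]_a f a = \big[op/idx]_(a < 2) f (a : C2)) //.
by rewrite big_ord_recl big_ord1; congr (op (f _) (f _)); apply: val_inj.
Qed.

Lemma bigC2_4 (R : Type) (idx : R) (op : Monoid.com_law idx) (f : C2_4 -> R) :
  \big[op/idx]_g f g = \big[op/idx]_(a : C2) \big[op/idx]_(b : C2)
    \big[op/idx]_(c : C2) \big[op/idx]_(d : C2) f (a, b, c, d).
Proof. by rewrite !pair_bigA; apply: eq_bigr => -[[[]]]. Qed.

Definition chi2 (a b : C2) : int := (-1) ^+ ((a : 'Z_2) * (b : 'Z_2))%N.

Lemma chi2M a b c : chi2 (a * b)%g c = chi2 a c * chi2 b c.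
Proof. by case: (C2P a) => ->; case: (C2P b) => ->; case: (C2P c) => ->. Qed.

(** The group is identified with its dual: [chi g] and [chi^~ h] are characters. *)
Definition chi (g h : C2_4) : int :=
  chi2 g.1.1.1 h.1.1.1 * chi2 g.1.1.2 h.1.1.2 * chi2 g.1.2 h.1.2 * chi2 g.2 h.2.

Lemma chi2C a b : chi2 a b = chi2 b a.
Proof. by rewrite /chi2 mulnC. Qed.

Lemma chi2_sign a b : chi2 a b = 1 \/ chi2 a b = -1.
Proof. by case: (C2P a) => ->; case: (C2P b) => ->; [left|left|left|right]. Qed.

Lemma chiC g h : chi g h = chi h g.
Proof. by rewrite /chi !(chi2C g.1.1.1, chi2C g.1.1.2, chi2C g.1.2, chi2C g.2). Qed.

Lemma chi_sign g h : chi g h = 1 \/ chi g h = -1.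
Proof. by rewrite /chi; do !apply: mulr_signed; apply: chi2_sign. Qed.

Lemma chiM g g' h : chi (g * g')%g h = chi g h * chi g' h.
Proof. by rewrite /chi !chi2M; ring. Qed.

Lemma chi1 h : chi 1%g h = 1.
Proof. by []. Qed.

Lemma chi_sum g : \sum_h chi g h = if g == 1%g then 16 else 0.
Proof.
rewrite bigC2_4 !bigC2; case: g => [[[a b] c] d].
by case: (C2P a) => ->; case: (C2P b) => ->; case: (C2P c) => ->;
  case: (C2P d) => ->.
Qed.

Lemma C2_4_mulV (g : C2_4) : (g^-1)%g = g.
Proof.
case: g => [[[a b] c] d].
by case: (C2P a) => ->; case: (C2P b) => ->; case: (C2P c) => ->;
  case: (C2P d) => ->; congr (_, _, _, _); apply: val_inj.
Qed.

Definition fourier (x : C2_4 -> int) (h : C2_4) : int := \sum_g chi g h * x g.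

Lemma chi_orth g g' : \sum_h chi g h * chi g' h = if g == g' then 16 else 0.
Proof.
under eq_bigr do rewrite -chiM.
by rewrite chi_sum -{1}(C2_4_mulV g') -eq_mulgV1.
Qed.

Lemma fourier_inv x g : \sum_h chi g h * fourier x h = 16 * x g.
Proof.
under eq_bigr do rewrite mulr_sumr.
rewrite exchange_big /=.
under eq_bigr do under eq_bigr do rewrite mulrA.
under eq_bigr do rewrite -mulr_suml chi_orth.
rewrite (bigD1 g) //= eqxx big1 ?addr0 // => g' ng.
by rewrite eq_sym (negPf ng) mul0r.
Qed.

Lemma big_enum (R : Type) (idx : R) (op : Monoid.com_law idx) (T : finType) (F : T -> R) :
  \big[op/idx]_(i < #|T|) F (enum_val i) = \big[op/idx]_t F t.
Proof. by rewrite [RHS](reindex _ (onW_bij _ (@enum_val_bij T))). Qed.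

(** The columns of the character table [H] are common eigenvectors of all group
matrices, with eigenvalues the character sums; [H] is invertible over the
rationals by orthogonality, so its determinant can be cancelled. *)
Lemma group_detE x : group_det x = \prod_h fourier x h.
Proof.
pose n := #|C2_4|.
pose H : 'M[int]_n := \matrix_(i, j) chi (enum_val i) (enum_val j).
pose y : 'rV[int]_n := \row_j fourier x (enum_val j).
have eMH : group_matrix x *m H = H *m diag_mx y.
  apply/matrixP => i j; rewrite mul_mx_diag !mxE.
  under eq_bigr do rewrite !mxE.
  rewrite (big_enum _ (fun g => x (enum_val i * g^-1)%g * chi g (enum_val j))).
  rewrite mulr_sumr (reindex_inj (mulIg (enum_val i))) /=.
  rewrite (reindex_inj invg_inj); apply: eq_bigr => g _.
  by rewrite invMg mulKVg invgK C2_4_mulV chiM; ring.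
have HH : H *m H = 16%:M.
  apply/matrixP => i j; rewrite !mxE.
  under eq_bigr do rewrite !mxE [X in _ * X]chiC.
  rewrite (big_enum _ (fun g => chi (enum_val i) g * chi (enum_val j) g)) chi_orth.
  by rewrite (inj_eq enum_val_inj); case: eqP.
have H0 : \det H != 0.
  apply: contraTneq isT => H0; move: (congr1 determinant HH).
  rewrite det_mulmx H0 mul0r det_scalar => /esym/eqP.
  by rewrite expf_eq0 andbF.
apply: (mulIf H0); rewrite -[in LHS]/(\det (group_matrix x) * _) -det_mulmx eMH det_mulmx.
rewrite mulrC det_diag; congr (_ * _).
under eq_bigr do rewrite mxE.
exact: (big_enum _ (fourier x)).
Qed.

(** * Character sums modulo 4 and odd determinants *)

(** Expanding the product of the [1 + m v i], every term with two factors [m v i]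
or more vanishes modulo [m ^ 2].  The case [m = 2] gives products of odd integers modulo
4, in particular products of signs. *)
Lemma prod_congr1 (I : finType) (P : pred I) (z : I -> int) (m : int) :
  (forall i, P i -> (m %| z i - 1)%Z) ->
  (m ^+ 2 %| \prod_(i | P i) z i - 1 - \sum_(i | P i) (z i - 1))%Z.
Proof.
(* The induction also needs the sum to be divisible by [m]. *)
move=> hz; suff [] : (m ^+ 2 %| \prod_(i | P i) z i - 1 - \sum_(i | P i) (z i - 1))%Z
  /\ (m %| \sum_(i | P i) (z i - 1))%Z by [].
elim/big_rec2: _ => [|i s p /hz /dvdzP[v zE] [/dvdzP[q pE] /dvdzP[r sE]]].
  by rewrite subrr !dvdz0.
split; apply/dvdzP; last by exists (v + r); rewrite zE sE mulrDl.
exists (v * (r + m * q) + q).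
have -> : z i = 1 + v * m by rewrite -zE addrC subrK.
have -> : p = 1 + r * m + q * m ^+ 2 by rewrite -sE -pE; ring.
by rewrite sE; ring.
Qed.

Lemma prod_odd_mod4 (I : finType) (P : pred I) (z : I -> int) :
  (forall i, P i -> (2 %| z i - 1)%Z) ->
  (4 %| \prod_(i | P i) z i - 1 - \sum_(i | P i) z i + #|P|%:Z)%Z.
Proof.
move=> /prod_congr1.
rewrite sumrB sumr_const (natz #|P|) (_ : 2 ^+ 2 = 4) // opprB addrA.
move: (\prod_(i | P i) _) (\sum_(i | P i) _) => p s.
by set n := #|P|; move: n => n; lia.
Qed.

Lemma prod_signs (I : finType) (P : pred I) (z : I -> int) :
  (forall i, P i -> z i = 1 \/ z i = -1) ->
  \prod_(i | P i) z i = 1 \/ \prod_(i | P i) z i = -1.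
Proof.
move=> hz; elim/big_ind: _ => [|a b|//]; first by left.
exact: mulr_signed.
Qed.

Lemma chi_expX g h (n : nat) : chi (g ^+ n)%g h = chi g h ^+ n.
Proof. by elim: n => // n IH; rewrite expgS chiM IH exprS. Qed.

(** For a sign [c], [(c - 1) n = c ^ n - 1] modulo 4.  Hence [y h - s], the sum of
the [(chi g h - 1) x g], is the sum of the [chi g h ^ (x g) - 1], which modulo 4
may be turned into a product; that product is a value of a single character. *)
Lemma fourier_mod4 x : exists t, forall h,
  (4 %| fourier x h - \sum_g x g - (chi t h - 1))%Z.
Proof.
(* Exponents matter only modulo 2, so the sign of [x g] can be dropped. *)
exists (\prod_g (g ^+ `|x g|)%g)%g => h.
rewrite (big_morph (fun g => chi g h) (fun a b => chiM a b h) (chi1 h)).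
under eq_bigr do rewrite chi_expX.
have sgnX (c : int) (n : nat) : c = 1 \/ c = -1 -> c ^+ n = if odd n then c else 1.
  by case=> ->; rewrite ?expr1n ?if_same // -signr_odd; case: odd.
have /prod_congr1/dvdzP[q qE] : forall g, xpredT g -> (2 %| chi g h ^+ `|x g| - 1)%Z.
  by move=> g _; rewrite sgnX; [case: (chi_sign g h) => ->; case: ifP|exact: chi_sign].
have -> : fourier x h - \sum_g x g = \sum_g (chi g h - 1) * x g.
  by rewrite -sumrB; apply: eq_bigr => g _; ring.
have /dvdzP[r rE] :
  (4 %| \sum_g (chi g h - 1) * x g - \sum_g (chi g h ^+ `|x g| - 1))%Z.
  rewrite -sumrB; elim/big_ind: _ => [|a b|g _]; [by []|exact: rpredD|].
  rewrite sgnX; last exact: chi_sign.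
  by case: (chi_sign g h) => ->; case: ifP; lia.
apply/dvdzP; exists (r - q); rewrite mulrBl -rE.
by rewrite (_ : 4 = 2 ^+ 2) // -qE; ring.
Qed.

(** The normalised character sums [e * chi t h * y h] are 1 modulo 4.  Their sum is
[16 e x t] by Fourier inversion, and passing to them does not change the product
because there are sixteen signs [e] and an even number of [h] with
[chi t h = -1]. *)
Lemma odd_group_det x : (2 %| \sum_g x g - 1)%Z ->
  (16 %| \prod_h fourier x h - 1)%Z.
Proof.
move=> sodd; have [t tE] := fourier_mod4 x.
have [e eS es] : exists2 e : int, e = 1 \/ e = -1 & (4 %| e * (\sum_g x g) - 1)%Z.
  have [|] : (4 %| (\sum_g x g) - 1)%Z \/ (4 %| (\sum_g x g) + 1)%Z by lia.
    by exists 1; [left|lia].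
  by exists (-1); [right|lia].
have : (4 ^+ 2 %| \prod_h (e * (chi t h * fourier x h)) - 1
                  - \sum_h (e * (chi t h * fourier x h) - 1))%Z.
  apply: prod_congr1 => h _; have := tE h; move: es; move: (\sum_g x g) (fourier x h) => s y.
  by case: eS => ->; case: (chi_sign t h) => ->; lia.
rewrite sumrB -mulr_sumr fourier_inv sumr_const 2!big_split /= prodr_const.
have cV : #|C2_4| = 16 by rewrite !card_prod card_ord.
have -> : \prod_h chi t h = 1.
  have S : \prod_h chi t h = 1 \/ \prod_h chi t h = -1.
    by apply: prod_signs => h _; exact: chi_sign.
  have : (4 %| \prod_h chi t h - 1 - \sum_h chi t h + #|C2_4|%:Z)%Z.
    by apply: prod_odd_mod4 => h _; case: (chi_sign t h) => ->.
  rewrite chi_sum cV; case: S => -> //; case: ifP => _; lia.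
rewrite cV (_ : e ^+ 16 = 1); last by case: eS => ->.
rewrite !mul1r opprB (natz 16) (_ : 4 ^+ 2 = 16) //.
by move: (\prod_h _) (x t) => p xt; case: eS => ->; lia.
Qed.

(** * Sums over half of the characters *)

(** The indicator of [chi t h = e] is [(1 + e chi t h) / 2]; multiplying by
[chi t] shifts the inverse transform by [t]. *)
Lemma half_fourier x t (e : int) g : e = 1 \/ e = -1 ->
  \sum_(h | chi t h == e) chi g h * fourier x h = 8 * (x g + e * x (t * g)%g).
Proof.
move=> eS; have : 2 * (\sum_(h | chi t h == e) chi g h * fourier x h)
   = 16 * x g + e * (16 * x (t * g)%g).
  rewrite -!fourier_inv big_mkcond !mulr_sumr -big_split /=.
  apply: eq_bigr => h _; rewrite chiM.
  by case: eS => ->; case: (chi_sign t h) => -> /=; ring.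
lia.
Qed.

(** This is [half_fourier] for the indicator of the identity, all of whose
character sums are 1. *)
Lemma half_chi t (e : int) g : e = 1 \/ e = -1 -> t != 1%g ->
  exists2 n : int, \sum_(h | chi t h == e) chi g h = 8 * n & g == 1%g -> n = 1.
Proof.
move=> eS t1; pose d (k : C2_4) : int := (k == 1%g)%:R.
have dE h : fourier d h = 1.
  rewrite /fourier (bigD1 1%g) //= big1 ?addr0 /d ?eqxx ?chi1 // => k /negPf ->.
  by rewrite mulr0.
exists (d g + e * d (t * g)%g); last first.
  by move=> /eqP ->; rewrite /d eqxx mulg1 (negPf t1) mulr0.
by rewrite -half_fourier //; apply: eq_bigr => h _; rewrite dE mulr1.
Qed.

Lemma half_sum1 t (e : int) : e = 1 \/ e = -1 -> t != 1%g ->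
  \sum_(h | chi t h == e) (1 : int) = 8.
Proof.
move=> eS t1; have [n nE] := half_chi 1%g eS t1.
move=> /(_ (eqxx _)) n1; move: nE; rewrite n1 mulr1 => sum8; apply: etrans sum8.
by apply: eq_bigr => h _; rewrite chi1.
Qed.

Lemma half_card t (e : int) : e = 1 \/ e = -1 -> t != 1%g ->
  #|[pred h | chi t h == e]|%:Z = 8.
Proof. by move=> eS t1; rewrite -(half_sum1 eS t1) sumr_const natz. Qed.

(** A product of signs is determined by the sum of the signs modulo 4, and here
both the sum and the number of factors are multiples of 8. *)
Lemma half_prod_chi t (e : int) g : e = 1 \/ e = -1 -> t != 1%g ->
  \prod_(h | chi t h == e) chi g h = 1.
Proof.
move=> eS t1; have [n nE _] := half_chi g eS t1.
have S : \prod_(h | chi t h == e) chi g h = 1 \/ \prod_(h | chi t h == e) chi g h = -1.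
  by apply: prod_signs => h _; exact: chi_sign.
have : (4 %| \prod_(h | chi t h == e) chi g h - 1 - \sum_(h | chi t h == e) chi g h
   + #|[pred h | chi t h == e]|%:Z)%Z.
  by apply: prod_odd_mod4 => h _; case: (chi_sign g h) => ->.
by rewrite nE half_card //; case: S => ->; lia.
Qed.

Lemma parseval x : \sum_h fourier x h ^+ 2 = 16 * \sum_g x g ^+ 2.
Proof.
under eq_bigr do rewrite expr2 {1}/fourier mulr_suml.
rewrite exchange_big mulr_sumr /=; apply: eq_bigr => g _.
under eq_bigr do rewrite mulrAC.
by rewrite -mulr_suml fourier_inv -mulrA.
Qed.

Lemma dvdz_sumB (I : finType) (P : pred I) (f g : I -> int) (m : int) :
  (forall i, P i -> (m %| f i - g i)%Z) ->
  (m %| \sum_(i | P i) f i - \sum_(i | P i) g i)%Z.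
Proof. by move=> fg; rewrite -sumrB; apply: rpred_sum. Qed.

Lemma dvdz_prodB (I : finType) (P : pred I) (f g : I -> int) (m : int) :
  (forall i, P i -> (m %| f i - g i)%Z) ->
  (m %| \prod_(i | P i) f i - \prod_(i | P i) g i)%Z.
Proof.
move=> fg; elim/big_rec2: _ => [|i b a /fg fgi ab]; first by rewrite subrr dvdz0.
rewrite (_ : _ - _ = (f i - g i) * a + g i * (a - b)); last by ring.
by apply: rpredD; [exact: dvdz_mulr|exact: dvdz_mull].
Qed.

Definition sg8 (n : int) : int := if (8 %| n - 1)%Z then 1 else -1.

Lemma sg8_sign n : sg8 n = 1 \/ sg8 n = -1.
Proof. by rewrite /sg8; case: ifP; [left|right]. Qed.

Lemma sg8P n : (8 %| n - 1)%Z || (8 %| n + 1)%Z -> (8 %| n - sg8 n)%Z.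
Proof. by rewrite /sg8; case: ifP => // _ /orP[|] //; lia. Qed.

Lemma half_fourierM x t (e c : int) (z : C2_4 -> int) g : e = 1 \/ e = -1 ->
  (forall h, chi t h == e -> fourier x h = c * z h) ->
  c * (\sum_(h | chi t h == e) chi g h * z h) = 8 * (x g + e * x (t * g)%g).
Proof.
move=> eS zE; rewrite -half_fourier // mulr_sumr.
by apply: eq_bigr => h th; rewrite zE // mulrCA.
Qed.

(** Let [sz], [su] be the signs to which [z], [u] are congruent modulo 8, and [F g],
[T g] their transforms over the two halves.  Then [F g = 4 (x g + e x (t g))] and
[T g = 2 (x g - e x (t g))] modulo 8, so [F g / 4] and [T g / 2] have the same
parity for every [g].  If the product of the [su] were -1, then so would be the
product of the [chi g h * su h] for every [g], making all [T g] equal to 2 modulo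
4, hence all [F g / 4] odd and [F g ^ 2 >= 16].  This contradicts Parseval: the
sixteen squares add up to [16 * 8 = 128].  The product of the [sz] is 1 because
their sum [F 1] is a multiple of 4. *)
Lemma half_prod_mod8 x t (e : int) (z u : C2_4 -> int) :
  e = 1 \/ e = -1 -> t != 1%g ->
  (forall h, chi t h == e -> fourier x h = 2 * z h) ->
  (forall h, chi t h == - e -> fourier x h = 4 * u h) ->
  (forall h, chi t h == e -> (8 %| z h - 1)%Z || (8 %| z h + 1)%Z) ->
  (forall h, chi t h == - e -> (8 %| u h - 1)%Z || (8 %| u h + 1)%Z) ->
  (8 %| (\prod_(h | chi t h == e) z h) * (\prod_(h | chi t h == - e) u h) - 1)%Z.
Proof.
move=> eS t1 zE uE z8 u8.
have eNS : - e = 1 \/ - e = -1 by case: eS => ->; [right|left].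
have sumz g : \sum_(h | chi t h == e) chi g h * z h = 4 * (x g + e * x (t * g)%g).
  have := half_fourierM g eS zE.
  by move: (\sum_(_ | _) _) (_ + _) => a b; lia.
have sumu g : \sum_(h | chi t h == - e) chi g h * u h = 2 * (x g - e * x (t * g)%g).
  have := half_fourierM g eNS uE; rewrite mulNr.
  by move: (\sum_(_ | _) _) (_ - _) => a b; lia.
pose sz h := sg8 (z h); pose su h := sg8 (u h).
pose F g := \sum_(h | chi t h == e) chi g h * sz h.
have FE g : (8 %| F g - 4 * (x g + e * x (t * g)%g))%Z.
  rewrite -sumz; apply: dvdz_sumB => h /z8/sg8P.
  by rewrite -mulrBr => ?; apply: dvdz_mull; rewrite -opprB rpredN.
have TE g : (8 %| \sum_(h | chi t h == - e) chi g h * su h - 2 * (x g - e * x (t * g)%g))%Z.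
  rewrite -sumu; apply: dvdz_sumB => h /u8/sg8P.
  by rewrite -mulrBr => ?; apply: dvdz_mull; rewrite -opprB rpredN.
have sumF : \sum_g F g ^+ 2 = 128.
  pose f h : int := if chi t h == e then sz h else 0.
  have FfE g : F g = fourier f g.
    rewrite /F big_mkcond /=; apply: eq_bigr => h _.
    by rewrite /f (chiC h g); case: ifP; rewrite ?mulr0.
  under eq_bigr do rewrite FfE.
  rewrite parseval (_ : \sum_g _ = \sum_(h | chi t h == e) (1 : int)).
    by rewrite half_sum1.
  rewrite [RHS]big_mkcond; apply: eq_bigr => h _.
  by rewrite /f; case: ifP => // _; rewrite /sz; case: (sg8_sign (z h)) => ->.
have szS : \prod_(h | chi t h == e) sz h = 1.
  have S : \prod_(h | chi t h == e) sz h = 1 \/ \prod_(h | chi t h == e) sz h = -1.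
    by apply: prod_signs => h _; exact: sg8_sign.
  have : (4 %| \prod_(h | chi t h == e) sz h - 1 - \sum_(h | chi t h == e) sz h
     + #|[pred h | chi t h == e]|%:Z)%Z.
    by apply: prod_odd_mod4 => h _; rewrite /sz; case: (sg8_sign (z h)) => ->.
  have F1 : F 1%g = \sum_(h | chi t h == e) sz h.
    by apply: eq_bigr => h _; rewrite chi1 mul1r.
  have := FE 1%g; rewrite F1 half_card //; case: S => -> //.
  move: (\sum_(_ | _) _) (x 1%g + _) => a b; lia.
have suS : \prod_(h | chi t h == - e) su h = 1.
  have [//|suN] : \prod_(h | chi t h == - e) su h = 1 \/ \prod_(h | chi t h == - e) su h = -1.
    by apply: prod_signs => h _; exact: sg8_sign.
  suff : 256 <= \sum_g F g ^+ 2 by rewrite sumF.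
  have -> : 256 = \sum_(g : C2_4) (16 : int).
    by rewrite sumr_const !card_prod card_ord.
  apply: Num.Theory.ler_sum => g _.
  have : (4 %| \prod_(h | chi t h == - e) (chi g h * su h) - 1
     - \sum_(h | chi t h == - e) (chi g h * su h)
     + #|[pred h | chi t h == - e]|%:Z)%Z.
    apply: prod_odd_mod4 => h _; rewrite /su.
    by case: (chi_sign g h) => ->; case: (sg8_sign (u h)) => ->.
  rewrite big_split /= half_prod_chi // suN half_card //.
  move: (TE g) (FE g).
  move: (\sum_(_ | _) _) (F g) (x g) (x (t * g)%g) => a f b c T4 F4 a4.
  have [k ->] : exists k, f = 4 * (2 * k + 1).
    exists ((f - 4) %/ 8)%Z; case: eS T4 F4 => ->; lia.
  nia.
have := dvdz_prodB (fun h th => sg8P (z8 h th)).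
have := dvdz_prodB (fun h th => sg8P (u8 h th)).
rewrite szS suS.
by move=> /dvdzP[a aE] /dvdzP[b bE]; apply/dvdzP; exists (a + b + 8 * a * b); nia.
Qed.

(** * Even determinants *)

(** If [d] is 3 modulo 8, the complementary factor of [N] must be 5, that is -3,
modulo 8; if [d] is -3 modulo 8, change the sign of both factors. *)
Lemma mod7_A (N d : int) : (8 %| N + 1)%Z -> (d %| N)%Z ->
  (8 %| d - 3)%Z || (8 %| d + 3)%Z -> A N.
Proof.
have A3 (c q : int) : (8 %| c * q + 1)%Z -> (8 %| c - 3)%Z -> A (q * c).
  move=> N7 /dvdzP[l cE].
  have [k ->] : exists k, q = 8 * k - 3.
    exists ((q + 3) %/ 8)%Z; rewrite (_ : c = 8 * l + 3) in N7; last by lia.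
    have : (8 %| 3 * q + 1)%Z by lia.
    lia.
  by exists k => //; exists l => //; congr (_ * _); lia.
move=> N7 /dvdzP[q NE]; move: N7; rewrite {}NE mulrC => N7 /orP[d3|d5]; rewrite mulrC.
  exact: A3.
by rewrite -mulrNN; apply: A3; [rewrite mulrNN|lia].
Qed.

Lemma dvdz_prod1 (I : finType) (P : pred I) (f : I -> int) i :
  P i -> (f i %| \prod_(j | P j) f j)%Z.
Proof. by move=> Pi; rewrite (bigD1 i) //= dvdz_mulr. Qed.

Lemma odd_prod (I : finType) (P : pred I) (f : I -> int) :
  (forall i, P i -> (2 %| f i - 1)%Z) -> (2 %| \prod_(i | P i) f i - 1)%Z.
Proof.
move=> fo; suff : (2 %| \prod_(i | P i) f i - \prod_(i | P i) 1)%Z by rewrite big1_eq.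
exact: dvdz_prodB.
Qed.

Lemma even_group_det x : (2 %| \sum_g x g)%Z ->
  [\/ exists m : int, \prod_h fourier x h = 2 ^+ 16 * (4 * m + 1),
      exists m : int, \prod_h fourier x h = 2 ^+ 26 * m
    | exists2 N : int, \prod_h fourier x h = 2 ^+ 24 * N &
        [\/ (4 %| N - 1)%Z, (8 %| N - 3)%Z | A N]].
Proof.
move=> s2; have [t tE] := fourier_mod4 x.
have cV : #|C2_4| = 16 by rewrite !card_prod card_ord.
have [t1|t1] := eqVneq t 1%g.
  have {tE t1}yE h : (4 %| fourier x h - \sum_g x g)%Z.
    by have := tE h; rewrite t1 chi1 subrr subr0.
  have [s4|s4] : (4 %| \sum_g x g)%Z \/ (4 %| \sum_g x g - 2)%Z.
    by move: s2; move: (\sum_g _) => s; lia.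
  - apply: Or32; exists (2 ^+ 6 * \prod_h (fourier x h %/ 4)%Z).
    rewrite (_ : \prod_h fourier x h = \prod_h (4 * (fourier x h %/ 4)%Z)).
      by rewrite big_split prodr_const cV /=; ring.
    apply: eq_bigr => h _; move: (yE h) s4.
    by move: (\sum_g _) (fourier x h) => s y; lia.
  - pose z h := (fourier x h %/ 2)%Z.
    have zE h : fourier x h = 2 * z h.
      rewrite /z; move: (yE h) s4; move: (\sum_g _) (fourier x h) => s y; lia.
    have zo h : (2 %| z h - 1)%Z.
      move: (yE h) s4; rewrite zE; move: (\sum_g _) (z h) => s y; lia.
    have sz : 2 * \sum_h z h = 16 * x 1%g.
      rewrite -fourier_inv mulr_sumr; apply: eq_bigr => h _.
      by rewrite chi1 mul1r zE.
    have : (4 %| \prod_h z h - 1 - \sum_h z h + #|C2_4|%:Z)%Z.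
      by apply: prod_odd_mod4 => h _; exact: zo.
    rewrite cV => zp; apply: Or31; exists ((\prod_h z h - 1) %/ 4)%Z.
    rewrite (eq_bigr _ (fun h _ => zE h)) big_split prodr_const cV /=.
    congr (_ * _); move: zp sz; move: (\prod_h _) (\sum_h _) (x 1%g) => p s a.
    lia.
(* [e] is the value of [chi t] on the half where [y h] is 2 modulo 4: it is 1 when
   [s] is 2 modulo 4, and -1 when 4 divides [s]. *)
have [e eS er] : exists2 e : int, e = 1 \/ e = -1 & (4 %| \sum_g x g + e + 1)%Z.
  have [s4|s4] : (4 %| \sum_g x g)%Z \/ (4 %| \sum_g x g - 2)%Z.
    by move: s2; move: (\sum_g _) => s; lia.
  - by exists (-1); [right|move: s4; move: (\sum_g _) => s; lia].
  - by exists 1; [left|move: s4; move: (\sum_g _) => s; lia].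
have eNS : - e = 1 \/ - e = -1 by case: eS => ->; [right|left].
pose z h := (fourier x h %/ 2)%Z.
pose u h := (fourier x h %/ 4)%Z.
have zE h : chi t h == e -> fourier x h = 2 * z h.
  move=> /eqP th; rewrite /z; move: (tE h) er; rewrite th.
  by move: (\sum_g _) (fourier x h) => s y; case: eS => ->; lia.
have zo h : chi t h == e -> (2 %| z h - 1)%Z.
  move=> th; move: (tE h) er; rewrite (zE _ th) (eqP th).
  by move: (\sum_g _) (z h) => s y; case: eS => ->; lia.
have uE h : chi t h == - e -> fourier x h = 4 * u h.
  move=> /eqP th; rewrite /u; move: (tE h) er; rewrite th.
  by move: (\sum_g _) (fourier x h) => s y; case: eS => ->; lia.
have DE : \prod_h fourier x h =
    2 ^+ 24 * ((\prod_(h | chi t h == e) z h) * (\prod_(h | chi t h == - e) u h)).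
  rewrite (bigID (fun h => chi t h == e)) /= (eq_bigr _ zE).
  rewrite [X in _ * X](eq_bigl (fun h => chi t h == - e)) => [|h]; last first.
    by case: (chi_sign t h) => ->; case: eS => ->.
  rewrite [X in _ * X](eq_bigr _ uE) !big_split !prodr_const /=.
  have := half_card eS t1; have := half_card eNS t1.
  by move=> [->] [->]; ring.
have [/existsP[h0 /andP[q0 e0]]|/existsPn uo] :=
  boolP [exists h, (chi t h == - e) && (2 %| u h)%Z].
  have [/existsP[h1 /and3P[n1 q1 e1]]|/existsPn uo] :=
      boolP [exists h, [&& h != h0, chi t h == - e & (2 %| u h)%Z]].
    have /dvdzP[q qE] : (4 %| \prod_(h | chi t h == - e) u h)%Z.
      rewrite (bigD1 h0) // (bigD1 h1) /= ?q1 //.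
      by rewrite mulrA dvdz_mulr // (dvdz_mul e0 e1).
    by apply: Or32; exists ((\prod_(h | chi t h == e) z h) * q); rewrite DE qE; ring.
  (* A single even [u h0] would make the sum of the eight [u h] odd. *)
  exfalso.
  have c1 := half_sum1 eNS t1.
  have := half_fourierM 1%g eNS uE.
  rewrite (eq_bigr u) => [|h _]; last by rewrite chi1 mul1r.
  have : (2 %| \sum_(h | (chi t h == - e) && (h != h0)) u h
     - \sum_(h | (chi t h == - e) && (h != h0)) (1 : int))%Z.
    apply: dvdz_sumB => h /andP[q1 n1]; have := uo h.
    by rewrite n1 q1 /=; move: (u h) => a; lia.
  rewrite (bigD1 h0) //= in c1; rewrite [X in 4 * X](bigD1 h0) //=.
  move: e0 c1; move: (u h0) (\sum_(_ | _) u _) (\sum_(_ | _) _) (x _ + _) => a b c d.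
  lia.
apply: Or33; rewrite DE; eexists; first by [].
set p := \prod_(_ | _ == e) _; set q := \prod_(_ | _) _.
have q1 h : chi t h == - e -> (2 %| u h - 1)%Z.
  by move=> th; have := uo h; rewrite th /=; move: (u h) => a; lia.
have po : (2 %| p - 1)%Z by apply: odd_prod.
have qo : (2 %| q - 1)%Z by apply: odd_prod.
have No : (2 %| p * q - 1)%Z.
  by move: po qo => /dvdzP[a aE] /dvdzP[b bE]; apply/dvdzP; exists (2 * a * b + a + b); nia.
have [N1|[N3|N7]] : (4 %| p * q - 1)%Z \/ (8 %| p * q - 3)%Z \/ (8 %| p * q + 1)%Z.
- by move: (p * q) No => N; lia.
- exact: Or31.
- exact: Or32.
apply: Or33.
have [/existsP[h /andP[th d3]]|/existsPn z8] :=
  boolP [exists h, (chi t h == e) && ((8 %| z h - 3)%Z || (8 %| z h + 3)%Z)].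
  by apply: mod7_A N7 _ d3; apply: dvdz_mulr; exact: dvdz_prod1.
have [/existsP[h /andP[th d3]]|/existsPn u8] :=
  boolP [exists h, (chi t h == - e) && ((8 %| u h - 3)%Z || (8 %| u h + 3)%Z)].
  by apply: mod7_A N7 _ d3; apply: dvdz_mull; exact: dvdz_prod1.
have : (8 %| p * q - 1)%Z.
  apply: half_prod_mod8 eS t1 zE uE _ _ => h th.
    by have := z8 h; have := zo h th; rewrite th /=; move: (z h) => a; lia.
  by have := u8 h; have := q1 h th; rewrite th /=; move: (u h) => a; lia.
by move: (p * q) N7 => N; lia.
Qed.

(** * Realising every value *)

Definition C2_4_index (g : C2_4) : nat :=
  8 * (g.1.1.1 : 'Z_2) + 4 * (g.1.1.2 : 'Z_2) + 2 * (g.1.2 : 'Z_2) + (g.2 : 'Z_2).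

Definition table (s : seq int) (g : C2_4) : int := s`_(C2_4_index g).

(** The fast Walsh-Hadamard transform: it produces the table of all character sums
in a form that reduces by computation. *)
Fixpoint walsh (n : nat) (s : seq int) : seq int :=
  if n is n'.+1 then
    let ps := zip (walsh n' (take (2 ^ n') s)) (walsh n' (drop (2 ^ n') s)) in
    [seq p.1 + p.2 | p <- ps] ++ [seq p.1 - p.2 | p <- ps]
  else s.

Lemma fourier_table (s : seq int) h : size s = 16%N ->
  fourier (table s) h = table (walsh 4 s) h.
Proof.
do 16 (case: s => // ? s); case: s => // _; case: h => [[[a b] c] d].
rewrite /fourier bigC2_4 !bigC2 /chi /table /C2_4_index /=.
by case: (C2P a) => ->; case: (C2P b) => ->; case: (C2P c) => ->;
  case: (C2P d) => ->; rewrite /chi2 /=; ring.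
Qed.

Lemma prod_table (r : seq int) : size r = 16%N ->
  \prod_h table r h = \prod_(y <- r) y.
Proof.
move=> r16; rewrite bigC2_4 !bigC2 /table /C2_4_index /=.
do 16 (case: r r16 => // ? r r16); case: r r16 => // _.
by rewrite !big_cons big_nil; ring.
Qed.

Lemma table_dets (s r : seq int) (N : int) : size s = 16%N -> walsh 4 s = r ->
  N = \prod_(y <- r) y -> group_dets C2_4 N.
Proof.
move=> s16 <- ->; exists (table s) => //; rewrite group_detE.
under eq_bigr do rewrite fourier_table //.
by apply: prod_table; do 16 (case: s s16 => // ? s s16); case: s s16.
Qed.

(** [s] is the table of [x], and [r] the table of its character sums, whose product
is visibly the value to be realised. *)
Ltac det_by_table s r :=
  apply: (@table_dets s r);
  [ by [] | by rewrite /=; do 16 (congr (_ :: _); first by ring)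
  | rewrite !big_cons big_nil; ring ].

Lemma int_parity (m : int) : exists l : int, m = 2 * l \/ m = 2 * l + 1.
Proof. by exists (m %/ 2)%Z; lia. Qed.

Lemma dets_1mod16 (m : int) : group_dets C2_4 (16 * m + 1).
Proof.
det_by_table [:: m + 1; m; m; m; m; m; m; m; m; m; m; m; m; m; m; m]
  [:: 16 * m + 1; 1; 1; 1; 1; 1; 1; 1; 1; 1; 1; 1; 1; 1; 1; 1].
Qed.

(** The first [y h / 2] is [4m + 1] and the others are signs.  The inverse transform
is integral when the transform of [(y - 2) / 4] is divisible by 4.  For odd [m]
this requires minus signs; they are put on the support of the bent function
[ab + cd], whose indicator has a transform with all values 2 modulo 4. *)
Lemma dets_pow16 (m : int) : group_dets C2_4 (2 ^+ 16 * (4 * m + 1)).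
Proof.
have [l [->|->]] := int_parity m.
  det_by_table [:: l + 2; l; l; l; l; l; l; l; l; l; l; l; l; l; l; l]
    [:: 16 * l + 2; 2; 2; 2; 2; 2; 2; 2; 2; 2; 2; 2; 2; 2; 2; 2].
det_by_table
  [:: l + 1; l + 1; l + 1; l; l + 1; l + 1; l + 1; l;
      l + 1; l + 1; l + 1; l; l; l; l; l + 1]
  [:: 16 * l + 10; 2; 2; - 2; 2; 2; 2; - 2; 2; 2; 2; - 2; - 2; - 2; - 2; 2].
Qed.

(** In the remaining families the character sums in the first half of the table are
[2 z] and those in the second half [4 u].  All [z] and [u] are signs, except where
a parameter enters and for one [u] equal to 2 in [dets_pow26]. *)
Lemma dets_pow24_1mod4 (m : int) : group_dets C2_4 (2 ^+ 24 * (4 * m + 1)).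
Proof.
det_by_table
  [:: m + 3; m; m; m; m; m; m; m; - m - 1; - m; - m; - m; - m; - m; - m; - m]
  [:: 2; 2; 2; 2; 2; 2; 2; 2; 16 * m + 4; 4; 4; 4; 4; 4; 4; 4].
Qed.

(** [8m + 3] and three minus signs make [z] equal to -1 modulo 4 on an affine plane.
The sum of the [(z - 1) / 2] is then 2 modulo 4, and integrality of the inverse
transform requires an odd number of the [u] to be -1 modulo 4: one of them is -1. *)
Lemma dets_pow24_3mod8 (m : int) : group_dets C2_4 (2 ^+ 24 * (8 * m + 3)).
Proof.
det_by_table
  [:: m + 2; m; m; m; m - 1; m; m; m; m - 1; m + 1; m + 1; m + 1; m; m + 1; m + 1; m + 1]
  [:: 16 * m + 6; - 2; - 2; - 2; 2; 2; 2; 2; - 4; 4; 4; 4; 4; 4; 4; 4].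
Qed.

(** The factor [8l + 3] sits among the [z] as in [dets_pow24_3mod8]; the [u] that was
-1 there becomes [3 - 8k], which is -1 modulo 4 as well. *)
Lemma dets_pow24_A (k l : int) :
  group_dets C2_4 (2 ^+ 24 * ((8 * k - 3) * (8 * l + 3))).
Proof.
det_by_table
  [:: l - 2 * k + 3; l - 2 * k + 1; l - 2 * k + 1; l - 2 * k + 1;
      l - 2 * k; l - 2 * k + 1; l - 2 * k + 1; l - 2 * k + 1;
      l + 2 * k - 2; l + 2 * k; l + 2 * k; l + 2 * k;
      l + 2 * k - 1; l + 2 * k; l + 2 * k; l + 2 * k]
  [:: 16 * l + 6; - 2; - 2; - 2; 2; 2; 2; 2; - 32 * k + 12; 4; 4; 4; 4; 4; 4; 4].
Qed.

(** Exactly two of the [u] are even, one of them 2 and the other [2m] or [- 2m].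
With two minus signs among the [z], integrality requires an odd number of minus
signs among the other [u] when [m] is even, and an even number when [m] is odd. *)
Lemma dets_pow26 (m : int) : group_dets C2_4 (2 ^+ 26 * m).
Proof.
have [l [->|->]] := int_parity m.
  det_by_table
    [:: - l + 2; l; - l; l + 1; - l - 1; l; - l; l + 1;
        l - 1; - l; l - 1; - l - 1; l; - l; l - 1; - l - 1]
    [:: - 2; - 2; 2; 2; 2; 2; 2; 2; 8; - 16 * l; - 4; 4; 4; 4; 4; 4].
det_by_table
  [:: l + 3; - l; l; - l; l; - l; l; - l; - l - 2; l; - l - 1; l; - l - 1; l; - l - 1; l]
  [:: - 2; - 2; 2; 2; 2; 2; 2; 2; 8; 16 * l + 8; 4; 4; 4; 4; 4; 4].
Qed.

(** * The determinants of C_2^4 *)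

(** The divisors of 7 are 1 and 7 up to sign, none of them congruent to 3 or -3
modulo 8. *)
Lemma seven_notin_A : ~ A 7.
Proof.
case=> k _ [l _ kl].
have k7 : (`|(8 * k - 3)%R| %| 7)%N.
  by apply/dvdnP; exists (`|(8 * l + 3)%R|)%N; rewrite mulnC -abszM kl.
move: k7 => /dvdn_leq k7; have {}k7 := k7 isT.
have [kE|kE] : 8 * k - 3 = 5 \/ 8 * k - 3 = -3 by lia.
  by move: kl; rewrite kE; lia.
by move: kl; rewrite kE; lia.
Qed.

Theorem theorem1p1 :
  A `<` [set 8 * m - 1 | m in [set: int]] /\
  group_dets C2_4 =
    [set 16 * m + 1 | m in [set: int]]
    `|` [set 2 ^+ 16 * (4 * m + 1) | m in [set: int]]
    `|` [set 2 ^+ 24 * (4 * m + 1) | m in [set: int]]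
    `|` [set 2 ^+ 24 * (8 * m + 3) | m in [set: int]]
    `|` [set 2 ^+ 24 * m' | m' in A]
    `|` [set 2 ^+ 26 * m | m in [set: int]].
Proof.
split.
  split.
    move=> /= _ [k _ [l _ <-]]; exists (8 * k * l + 3 * k - 3 * l - 1) => //; ring.
  by move=> /(_ 7) H; apply: seven_notin_A; apply: H; exists 1.
apply/seteqP; split=> [_ [x _ <-]|N]; last first.
  move=> -[[[[[]|]|]|]|] [m].
  - by move=> _ <-; exact: dets_1mod16.
  - by move=> _ <-; exact: dets_pow16.
  - by move=> _ <-; exact: dets_pow24_1mod4.
  - by move=> _ <-; exact: dets_pow24_3mod8.
  - by move=> [k _ [l _ <-]] <-; exact: dets_pow24_A.
  - by move=> _ <-; exact: dets_pow26.
rewrite group_detE.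
have [s2|s1] : (2 %| \sum_g x g)%Z \/ (2 %| \sum_g x g - 1)%Z.
  by move: (\sum_g _) => s; lia.
- case: (even_group_det s2) => [[m ->]|[m ->]|[N ->]].
  + by do 4 left; right; exists m.
  + by right; exists m.
  + case=> [|/dvdzP[m NE]|AN].
    * move=> /dvdzP[m NE]; do 3 left; right; exists m => //.
      by rewrite [4 * m]mulrC -NE subrK.
    * by do 2 left; right; exists m => //; rewrite [8 * m]mulrC -NE subrK.
    * by left; right; exists N.
- have /dvdzP[m DE] := odd_group_det s1.
  by do 5 left; exists m => //; rewrite [16 * m]mulrC -DE subrK.
Qed.
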